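(* Let $Q$ be a polynomial ring over a field and let $I$ be a proper monomial ideal of $Q$ with minimal monomial generators $m_1,\dots,m_q$. If $\operatorname{Scarf-number}(I)\ge q-1$, then $Q/I$ has a minimal pivot resolution. In particular, if $q\le3$, then $Q/I$ has a minimal pivot resolution.
   Context: Notation. $[q]=\{1,\dots,q\}$, $\mathcal{P}([q])$ is its power set. For $A\subseteq[q]$ put $m_A=\operatorname{lcm}(m_i : i\in A)$, with $m_\emptyset=1$. Scarf number. $\operatorname{Scarf-number}(I)=\inf\{t\in\mathbb{N} : \exists\,\tau,\tau'\in\mathcal{P}([q])\text{ with }\tau\ne\tau',\ |\tau|=t,\ m_\tau=m_{\tau'}\}$ (equal to $\infty$ if no such $t$ exists). Taylor resolution. $\mathcal{T}$ is the complex of free $Q$-modules whose degree-$i$ component has basis $\{\epsilon_\tau : \tau\in\mathcal{P}([q]),\ |\tau|=i\}$, with differential $\partial(\epsilon_\tau)=\sum_{j\in\tau}(-1)^{|\{k\in\tau : k<j\}|}\frac{m_\tau}{m_{\tau\setminus\{j\}}}\epsilon_{\tau\setminus\{j\}}$. It is a free resolution of $Q/I$. Pivot complexes. A pivot complex of $Q/I$ is either $\mathcal{T}$ itself or, for some integer $l\ge2$ and $i_1<\dots<i_l$ in $[q]$, the subcomplex $\mathcal{T}_{i_1,\dots,i_l}$ of $\mathcal{T}$ spanned over $Q$ by the $\epsilon_\sigma$ with $\sigma\nsupseteq\{i_1,\dots,i_l\}$. A pivot resolution of $Q/I$ is a pivot complex that is a free resolution of $Q/I$ ($H_0=Q/I$,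 $H_i=0$ for $i>0$). It is minimal if $\partial(F_i)\subseteq\mathfrak{m}F_{i-1}$ for all $i$, where $F_i$ is its component in degree $i$ and $\mathfrak{m}$ is the ideal generated by the variables of $Q$. *)

(* Defs.v *)
From HB Require Import structures.
From mathcomp Require Import all_boot all_order all_algebra.
From mathcomp Require Export mpoly.

Set Implicit Arguments.
Unset Strict Implicit.
Unset Printing Implicit Defensive.

Import GRing.Theory.
Local Open Scope ring_scope.
Local Open Scope quotient_scope.

(* Sequences of finite free modules F_i = R^(basis i) and linear maps
   F_(i+1) -> F_i.  The condition d \o d = 0 is not a field: it is part of
   [is_resolution], where exactness is kernel = image. *)
Record free_seq (R : comNzRingType) := FreeSeq {
  basis : nat -> finType;
  fdiff : forall i,
    {linear {ffun basis i.+1 -> R^o} -> {ffun basis i -> R^o}}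
}.

Section Resolutions.
Variable R : comNzRingType.

Local Notation chain F i := {ffun basis F i -> R^o}.

(* H_0 = R/I is expressed by an R-linear surjection F_0 -> R/I whose kernel is
   the image of F_1; R acts on the quotient ring R/I through \pi. *)
Definition is_resolution (I : idealr R) (F : free_seq R) : Prop :=
  (exists e : {linear chain F 0 -> {ideal_quot I}
                 | (\pi_{ideal_quot I} : R -> {ideal_quot I}) \; *%R},
      (forall z, exists x, e x = z) /\
      (forall x, e x = 0 <-> exists y, fdiff F 0 y = x)) /\
  (forall i (x : chain F i.+1),
      fdiff F i x = 0 <-> exists y, fdiff F i.+1 y = x).

(* The submodule J V. *)
Definition ideal_mul (J : R -> Prop) (V : lmodType R) (v : V) : Prop :=
  exists2 s : seq (R * V),
    forall a, a \in s -> J a.1 & v = \sum_(a <- s) a.1 *: a.2.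

Definition is_minimal (J : R -> Prop) (F : free_seq R) : Prop :=
  forall i (x : chain F i.+1), ideal_mul J (fdiff F i x).

End Resolutions.

Section MonomialIdeals.
Variables (k : fieldType) (n q : nat).
Variable m : 'I_q -> 'X_{1..n}.

Local Notation Q := {mpoly k[n]}.

Definition max_ideal (p : Q) : Prop :=
  exists c : 'I_n -> Q, p = \sum_j c j * 'X_j.

Definition generated_by (A : {set 'I_q}) (I : {pred Q}) : Prop :=
  forall p, p \in I <-> exists c : 'I_q -> Q, p = \sum_(i in A) c i * 'X_[m i].

Definition minimal_generators (I : {pred Q}) : Prop :=
  generated_by setT I /\ forall A, generated_by A I -> A = setT.

Definition lcm_mon (A : {set 'I_q}) : 'X_{1..n} :=
  \big[@mlcm n/0%MM]_(i in A) m i.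

Definition has_twin (tau : {set 'I_q}) : bool :=
  [exists tau' : {set 'I_q}, (tau != tau') && (lcm_mon tau == lcm_mon tau')].

(* [None] stands for infinity. *)
Definition scarf_number : option nat :=
  if [pick tau | has_twin tau] is Some tau0
  then Some #|[arg min_(tau < tau0 | has_twin tau) #|tau| ]|
  else None.

Definition leq_inf (t : nat) (s : option nat) : bool :=
  if s is Some u then (t <= u)%N else true.

(* The span of the e_tau, tau in Delta, inside the Taylor resolution.  It is a
   subcomplex when Delta is closed under removing elements, as is the case for
   the pivot complexes. *)
Section TaylorSpan.
Variable Delta : {set {set 'I_q}}.

Definition face (i : nat) : finType :=
  {tau : {set 'I_q} | (tau \in Delta) && (#|tau| == i)}.

(* The basis vector e_tau (0 if tau is not a face of cardinal i). *)
Definition taylor_basis (i : nat) (tau : {set 'I_q}) : {ffun face i -> Q^o} :=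
  [ffun sigma => (val sigma == tau)%:R].

Definition taylor_diff (i : nat) (x : {ffun face i.+1 -> Q^o}) :
    {ffun face i -> Q^o} :=
  \sum_(tau : face i.+1) x tau *:
    \sum_(j in val tau)
      ((-1) ^+ #|[set l in val tau | (l < j)%N]|
         * 'X_[(lcm_mon (val tau) - lcm_mon (val tau :\ j))%MM] : Q)
      *: taylor_basis i (val tau :\ j).

Fact taylor_diff_is_linear i : linear (@taylor_diff i).
Proof.
move=> a x y; rewrite /taylor_diff scaler_sumr -big_split /=.
by apply: eq_bigr => tau _; rewrite !ffunE scalerDl scalerA.
Qed.

HB.instance Definition _ i := GRing.isLinear.Build Q
  {ffun face i.+1 -> Q^o} {ffun face i -> Q^o} _ (@taylor_diff i)
  (@taylor_diff_is_linear i).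

Definition taylor_span : free_seq Q :=
  FreeSeq (fun i => GRing.Linear.clone _ _ _ _ (@taylor_diff i) _).

End TaylorSpan.

Definition pivot_faces (P : {set 'I_q}) : {set {set 'I_q}} :=
  [set sigma : {set 'I_q} | ~~ (P \subset sigma)].

Definition is_pivot_complex (F : free_seq Q) : Prop :=
  F = taylor_span setT \/
  exists P : {set 'I_q}, (2 <= #|P|)%N /\ F = taylor_span (pivot_faces P).

Definition has_minimal_pivot_resolution (I : idealr Q) : Prop :=
  exists F : free_seq Q,
    [/\ is_pivot_complex F, is_resolution I F & is_minimal max_ideal F].

Lemma pivot_faces_closed (P tau : {set 'I_q}) (j : 'I_q) :
  tau \in pivot_faces P -> tau :\ j \in pivot_faces P.
Proof. by rewrite !inE; apply: contra => /subset_trans-> //; apply: subD1set. Qed.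

End MonomialIdeals.

(* Main.v *)
(* Multiplying the coefficient of e_A by m_A embeds the Taylor complex into the
   chains of the full simplex with coefficients in Q.  In each multidegree b only
   the generators dividing b matter, and coning off the smallest of them contracts
   the complex; hence the Taylor complex is a resolution.  If it is not minimal,
   two subsets A and A \ j have the same lcm, and the Scarf condition forces A to
   be the set of all generators.  The pivot complex on P = [q] \ j omits exactly
   e_[q] and e_P, which cancel because m_P = m_[q], so it is still a resolution;
   it is minimal because no two of its remaining subsets A and A \ l have the
   same lcm.  When q <= 3, twins of cardinal 0 or 1 are excluded by properness and
   by minimality of the generators. *)
Require Import Defs.
From HB Require Import structures.
From mathcomp Require Import all_boot all_order all_algebra.
From mathcomp Require Import mpoly.
Import GRing.Theory.
Local Open Scope ring_scope.
Local Open Scope quotient_scope.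

Set Implicit Arguments.
Unset Strict Implicit.
Unset Printing Implicit Defensive.

(** * The boundary map of the full simplex and its cone homotopy *)

Section SimplexBoundary.
Variables (q : nat) (R : comNzRingType).
Implicit Types (A : {set 'I_q}) (f g : {set 'I_q} -> R) (j l s : 'I_q).

Definition nbelow A j := #|[set l in A | (l < j)%N]|.

Lemma nbelowU1 A j l :
  l \notin A -> nbelow (l |: A) j = ((l < j) + nbelow A j)%N.
Proof.
move=> lA; rewrite /nbelow; case: ltnP => lj.
  have -> : [set i in l |: A | (i < j)%N] = l |: [set i in A | (i < j)%N].
    by apply/setP => i; rewrite !inE; case: eqP => [->|].
  by rewrite cardsU1 inE (negPf lA).
apply: eq_card => i; rewrite !inE.
by case: eqP => [->|//]; rewrite ltnNge lj (negPf lA).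
Qed.

(** The simplicial boundary read on coefficients: [f] is the chain with coefficient [f B] at [B],
    and the faces reached from [A] by adding one vertex contribute at [A]. *)
Definition bd f A : R := \sum_(j | j \notin A) (-1) ^+ nbelow A j * f (j |: A).

Lemma eq_bd f g : f =1 g -> bd f =1 bd g.
Proof. by move=> fg A; apply: eq_bigr => j _; rewrite fg. Qed.

Lemma bdB f g A : bd (fun B => f B - g B) A = bd f A - bd g A.
Proof. by rewrite /bd -sumrB; apply: eq_bigr => j _; rewrite mulrBr. Qed.

Lemma bdZ c f A : bd (fun B => c * f B) A = c * bd f A.
Proof. by rewrite /bd mulr_sumr; apply: eq_bigr => j _; rewrite mulrCA. Qed.

(** The pairs [(j, l)] and [(l, j)] reach the same set with opposite signs, since only the larger
    vertex sees the smaller one below it. *)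
Lemma bd_bd f A : bd (bd f) A = 0.
Proof.
rewrite /bd; under eq_bigr do rewrite mulr_sumr.
rewrite pair_big_dep (bigID (fun p : 'I_q * 'I_q => (p.1 < p.2)%N)) /=.
rewrite [X in _ + X](reindex_inj (h := fun p => (p.2, p.1))); last first.
  by case=> a b [c d] [-> ->].
apply/eqP; rewrite addr_eq0 -sumrN /=; apply/eqP/eq_big => -[j l] /=.
  rewrite !inE !negb_or -leqNgt (eq_sym l) -(inj_eq val_inj) /=.
  by case: ltngtP; rewrite ?andbF ?andbT // andbC.
rewrite !inE negb_or => /andP[/and3P[jA _ lA] jl].
rewrite !nbelowU1 // jl ltnNge (ltnW jl) /= add0n exprS setUCA.
by rewrite !mulN1r !mulNr mulrN !mulrA [X in X * f _]mulrC.
Qed.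

(* The contracting homotopy of the cone with apex [s]: when [s] is the smallest
   vertex, adding it never produces a sign. *)
Definition cone s f A : R := if s \in A then f (A :\ s) else 0.

Lemma bd_cone s (S : {set 'I_q}) f :
  s \in S -> (forall j, j \in S -> (s <= j)%N) ->
  (forall A, f A != 0 -> A \subset S) -> bd f =1 (fun=> 0) ->
  bd (cone s f) =1 f.
Proof.
move=> sS s_min fS bd0 A; rewrite /bd /cone.
have sgn1 : (-1) ^+ nbelow (A :\ s) s * f A = f A.
  have [->|fA0] := eqVneq (f A) 0; first by rewrite mulr0.
  suff -> : nbelow (A :\ s) s = 0%N by rewrite mul1r.
  apply/eqP; rewrite cards_eq0; apply/eqP/setP => i; rewrite !inE.
  apply/negP => /andP[/andP[_ iA]]; rewrite ltnNge s_min //.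
  exact: (subsetP (fS _ fA0)).
(* If [s] is not in [A], only the term that adds [s] survives. *)
have [sA|sA] := boolP (s \in A); last first.
  have As : A :\ s = A.
    by apply/setP => i; rewrite !inE; case: eqP => // ->; rewrite (negPf sA).
  rewrite As in sgn1.
  rewrite (bigD1 s) //= setU11 setU1K // big1 ?addr0 // => j /andP[_ js].
  by rewrite !inE eq_sym (negPf js) (negPf sA) mulr0.
(* If [s] is in [A], the cycle condition at [A :\ s] expresses [f A] through the terms of the
   boundary of the cone; the signs differ because [s] lies below each [j]. *)
have := bd0 (A :\ s); rewrite /bd (bigD1 s) ?setD11 //= setD1K // sgn1.
move=> /eqP; rewrite addr_eq0 => /eqP ->; rewrite -sumrN.
apply: eq_big => [j|j jA].
  by rewrite !inE; case: eqP => [->|]; rewrite ?sA ?andbT.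
rewrite !inE sA orbT; have js : j != s by apply: contraNneq jA => ->.
have -> : (j |: A) :\ s = j |: (A :\ s).
  apply/setP => i; rewrite !inE; case: eqP => [->|//].
  by rewrite eq_sym (negPf js).
have [->|fj] := eqVneq (f (j |: A :\ s)) 0; first by rewrite !mulr0 oppr0.
have sj : (s < j)%N.
  rewrite ltn_neqAle (inj_eq val_inj) eq_sym js s_min //.
  by apply: (subsetP (fS _ fj)); rewrite !inE eqxx.
by rewrite -{1}(setD1K sA) nbelowU1 ?setD11 // sj exprS mulN1r mulNr.
Qed.

End SimplexBoundary.

(** * Divisibility by monomials, read on supports *)

Section Monomials.
Variables (R : comNzRingType) (n : nat).
Implicit Types (p : {mpoly R[n]}) (a b : 'X_{1..n}).

Lemma lem_anti a b : (a <= b)%MM -> (b <= a)%MM -> a = b.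
Proof.
move=> /mnm_lepP ab /mnm_lepP ba; apply/mnmP => i.
by apply/eqP; rewrite eqn_leq ab ba.
Qed.

Definition mfilter (P : pred 'X_{1..n}) p : {mpoly R[n]} :=
  \sum_(b <- msupp p | P b) p@_b *: 'X_[b].

Lemma mcoeff_mfilter P p b : (mfilter P p)@_b = if P b then p@_b else 0.
Proof.
rewrite /mfilter raddf_sum /= big_mkcond /=.
have [bp|/memN_msupp_eq0 pb] := boolP (b \in msupp p).
  rewrite (bigD1_seq b) ?msupp_uniq //= big1 ?addr0.
    by case: ifP; rewrite ?mcoeffZ ?mcoeffX ?eqxx ?mulr1.
  by move=> a ab; rewrite mcoeffZ mcoeffX (negPf ab) mulr0 if_same.
rewrite pb if_same big1_seq // => a /andP[_ ap].
rewrite mcoeffZ mcoeffX; case: (a =P b) => [->|_].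
  by rewrite pb mul0r if_same.
by rewrite mulr0 if_same.
Qed.

Lemma mpoly_divX a p :
  (forall b, b \in msupp p -> (a <= b)%MM) -> exists r, p = r * 'X_[a].
Proof.
move=> ap; exists (\sum_(b <- msupp p) p@_b *: 'X_[b - a]).
rewrite mulr_suml {1}[p]mpolyE; apply: eq_big_seq => b /ap ab.
by rewrite -scalerAl -mpolyXD submK.
Qed.

Lemma msupp_mulX a p b : b \in msupp (p * 'X_[a]) -> (a <= b)%MM.
Proof.
by rewrite (perm_mem (msuppMX _ _)) => /mapP[c _ ->]; rewrite lem_addr.
Qed.

Lemma mulX_inj a : injective (fun p => p * 'X_[a]).
Proof.
by move=> p r pr; apply/mpolyP => b; rewrite -(mcoeffMX p a) pr mcoeffMX.
Qed.

End Monomials.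

(** * Least common multiples of sets of generators *)

Section LcmMon.
Variables (n q : nat) (m : 'I_q -> 'X_{1..n}).
Implicit Types (A B : {set 'I_q}) (b : 'X_{1..n}).

Lemma lcm_mon_le A b : (lcm_mon m A <= b)%MM = (A \subset [set i | m i <= b]%MM).
Proof.
rewrite /lcm_mon (big_morph (fun a => (a <= b)%MM) (id1 := true) (op1 := andb)).
- rewrite big_all_cond; apply/allP/subsetP => H i => [iA|_].
    by have := H i (mem_index_enum _); rewrite /= iA inE.
  by apply/implyP => /H; rewrite inE.
- by move=> a c; rewrite lem_mlcm.
- by apply/mnm_lepP => i; rewrite mnm0E.
Qed.

Lemma le_lcm_mon A i : i \in A -> (m i <= lcm_mon m A)%MM.
Proof.
move=> iA; have := lepm_refl (lcm_mon m A).
by rewrite lcm_mon_le => /subsetP/(_ i iA); rewrite inE.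
Qed.

Lemma lcm_mon_sub A B : A \subset B -> (lcm_mon m A <= lcm_mon m B)%MM.
Proof.
move=> AB; rewrite lcm_mon_le; apply/subsetP => i /(subsetP AB) iB.
by rewrite inE le_lcm_mon.
Qed.

Lemma lcm_mon0 : lcm_mon m set0 = 0%MM.
Proof. exact: big_set0. Qed.

Lemma lcm_mon1 i : lcm_mon m [set i] = m i.
Proof.
apply: lem_anti; last by rewrite le_lcm_mon ?set11.
by rewrite lcm_mon_le sub1set inE lepm_refl.
Qed.

End LcmMon.

(** * Exactness at the level of homogenized coefficients *)

Section TaylorExact.
Variables (k : fieldType) (n q : nat) (m : 'I_q -> 'X_{1..n}).
Local Notation Q := {mpoly k[n]}.
Implicit Types (g h : {set 'I_q} -> Q) (A : {set 'I_q}) (b : 'X_{1..n}).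

(** Divisibility of each [g A] by the monomial m_A, phrased on exponents so that it can be checked
    in one multidegree at a time. *)
Definition lcm_divides g :=
  forall A b, b \in msupp (g A) -> (lcm_mon m A <= b)%MM.

Definition concentrated g (d : nat) := forall A, g A != 0 -> #|A| = d.

(** Such an [s] is the apex of the cone used in multidegree [b]. *)
Definition first_divisor b (s : 'I_q) :=
  (m s <= b)%MM && [forall i : 'I_q, (m i <= b)%MM ==> (s <= i)%N].

Lemma mcoeff_bd g A b : (bd g A)@_b = bd (fun B => (g B)@_b) A.
Proof.
rewrite /bd raddf_sum /=; apply: eq_bigr => j _.
rewrite -[in LHS]signr_odd -[in RHS]signr_odd.
by case: odd; rewrite /= ?expr1 ?expr0 ?mul1r ?mulN1r ?mcoeffN.
Qed.

Lemma taylor_exact g d :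
  lcm_divides g -> concentrated g d.+1 -> bd g =1 (fun=> 0) ->
  exists h, [/\ lcm_divides h, concentrated h d.+2 & bd h =1 g].
Proof.
move=> g_div gd bdg.
(* This glues the cones of all multidegrees: a term of [g (A :\ s)] is kept exactly when [s] is the
   apex for its exponent. *)
pose h A := \sum_(s in A) mfilter (first_divisor^~ s) (g (A :\ s)).
have g_sub b A : (g A)@_b != 0 -> A \subset [set i | m i <= b]%MM.
  by rewrite -mcoeff_msupp -lcm_mon_le; apply: g_div.
exists h; split.
- move=> A b; rewrite mcoeff_msupp raddf_sum /=; apply: contraR => bA.
  rewrite big1 // => s sA; rewrite mcoeff_mfilter; case: ifP => // /andP[sb _].
  apply/eqP; apply: contraR bA => /g_sub gsub.
  rewrite lcm_mon_le -(setD1K sA); apply/subsetP => i /setU1P[->|].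
    by rewrite inE.
  exact: (subsetP gsub).
- move=> A hA; have [s sA gs] : exists2 s, s \in A & g (A :\ s) != 0.
    apply/exists_inP; apply: contraR hA; rewrite negb_exists_in => /forall_inP g0.
    rewrite /h big1 // => s /g0; rewrite negbK => /eqP ->.
    by rewrite /mfilter msupp0 big_nil.
  by rewrite (cardsD1 s) sA (gd _ gs).
move=> A; apply/mpolyP => b; rewrite mcoeff_bd.
(* Without a generator dividing [b] there is no apex, but then [g] has no coefficient at [b]: it
   lives on nonempty sets, whose elements would divide [b]. *)
have [|no_div] := boolP [exists i, m i <= b]%MM; last first.
  have g0 B : (g B)@_b = 0.
    apply/eqP; apply: contraR no_div => gB; apply/existsP.
    have /set0Pn[i iB] : B != set0.
      rewrite -card_gt0 (gd B) //.
      by apply: contraNneq gB => ->; rewrite mcoeff0.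
    by exists i; have := subsetP (g_sub _ _ gB) i iB; rewrite inE.
  rewrite g0 /bd big1 // => j _; rewrite raddf_sum /= big1 ?mulr0 // => s _.
  by rewrite mcoeff_mfilter g0 if_same.
case/existsP => i0 i0b.
case: (arg_minnP (P := fun i => (m i <= b)%MM) (@nat_of_ord q) i0b) => s sb s_min.
have first_s i : first_divisor b i = (i == s).
  apply/andP/eqP => [[ib /forallP/(_ s)]|->].
    by rewrite sb /= => i_s; apply/val_inj/eqP; rewrite eqn_leq i_s s_min.
  by split=> //; apply/forallP => i'; apply/implyP => /s_min.
rewrite -(@bd_cone _ _ s [set i | m i <= b]%MM (fun B => (g B)@_b)) ?inE //.
- apply: eq_bd => B; rewrite /h raddf_sum /= /cone; case: ifP => sB.
    rewrite (bigD1 s) //= mcoeff_mfilter first_s eqxx big1 ?addr0 //.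
    by move=> j /andP[_ js]; rewrite mcoeff_mfilter first_s (negPf js).
  rewrite big1 // => j jB; rewrite mcoeff_mfilter first_s.
  by case: eqP jB => // ->; rewrite sB.
- by move=> j; rewrite inE; apply: s_min.
- exact: g_sub.
by move=> B; rewrite -mcoeff_bd bdg mcoeff0.
Qed.

(* The quotient of the Taylor complex by the pivot complex is spanned by
   [setT] and [setT :\ j0], joined by a unit of the boundary map; the
   [setT :\ j0]-component of a preimage is removed by a boundary. *)
Lemma pivot_exact (j0 : 'I_q) g d :
  lcm_mon m (setT :\ j0) = lcm_mon m setT ->
  lcm_divides g -> concentrated g d.+1 ->
  bd g =1 (fun=> 0) -> g (setT :\ j0) = 0 ->
  exists h, [/\ lcm_divides h, concentrated h d.+2, bd h =1 g
    & h (setT :\ j0) = 0 /\ h setT = 0].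
Proof.
move=> lcmP g_div gd bdg gP.
have [h [h_div hd bdh]] := taylor_exact g_div gd bdg.
pose e (A : {set 'I_q}) : Q := (A == setT)%:R.
(* The multiple of the boundary of the top cell that matches [h] at [setT :\ j0]. *)
pose u := (-1) ^+ nbelow (setT :\ j0) j0 * h (setT :\ j0).
pose h' A := h A - u * bd e A.
have notin1 (j : 'I_q) : (j \notin setT :\ j0) = (j == j0).
  by rewrite !inE andbT negbK.
have bdP f : bd f (setT :\ j0) = (-1) ^+ nbelow (setT :\ j0) j0 * f setT :> Q.
  rewrite /bd (big_pred1 j0); last by move=> j; rewrite notin1.
  by rewrite setD1K ?inE.
have sgnK (p : Q) r : (-1) ^+ r * ((-1) ^+ r * p) = p.
  by rewrite mulrA -exprD addnn -signr_odd odd_double mul1r.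
have bdeT : bd e setT = 0 by rewrite /bd big_pred0 // => j; rewrite inE.
have bdh' : bd h' =1 g.
  by move=> A; rewrite bdB bdZ bd_bd mulr0 subr0 bdh.
have e_div A : bd e A != 0 -> exists2 j, j \notin A & j |: A == setT.
  move=> eA; apply/exists_inP; apply: contraR eA.
  rewrite negb_exists_in => /forall_inP A0; rewrite /bd big1 // => j jA.
  by rewrite /e (negPf (A0 j jA)) mulr0.
have h'P : h' (setT :\ j0) = 0.
  rewrite /h' bdP /e eqxx mulr1 /u.
  by rewrite mulrAC -expr2 sqrr_sign mul1r subrr.
(* Up to sign, [h' setT] is the value of [bd h'] at [setT :\ j0], that is [g (setT :\ j0)]. *)
have h'T : h' setT = 0.
  by rewrite -[LHS](sgnK _ (nbelow (setT :\ j0) j0)) -bdP bdh' gP mulr0.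
exists h'; split=> //.
- move=> A b; have [/h_div //|hA] := boolP (b \in msupp (h A)).
  (* The correction keeps divisibility: by the equality of lcms, [u] is a multiple of the lcm of all
     generators. *)
  have [r hP] : exists r, h (setT :\ j0) = r * 'X_[lcm_mon m setT].
    by apply: mpoly_divX => c /h_div; rewrite lcmP.
  rewrite mcoeff_msupp mcoeffB (memN_msupp_eq0 hA) sub0r oppr_eq0 -mcoeff_msupp.
  rewrite /u hP mulrA mulrAC => /msupp_mulX; apply: lepm_trans.
  exact/lcm_mon_sub/subsetT.
- move=> A h'A; have [hA|/hd //] := eqVneq (h A) 0.
  move: h'A; rewrite /h' hA sub0r oppr_eq0 => uA.
  (* The correction keeps the degree: it lives on sets missing one vertex, which have the cardinal
     of [setT :\ j0], where [h] is nonzero. *)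
  have [j jA /eqP jT] : exists2 j, j \notin A & j |: A == setT.
    by apply: e_div; apply: contraNneq uA => ->; rewrite mulr0.
  have /hd <- : h (setT :\ j0) != 0.
    by apply: contraNneq uA; rewrite /u => ->; rewrite mulr0 mul0r.
  apply/eqP; rewrite -eqSS -[X in X == _]/(1 + #|A|)%N.
  have -> : (1 + #|A| = #|j |: A|)%N by rewrite cardsU1 jA.
  by rewrite jT (cardsD1 j0) inE.
Qed.
End TaylorExact.

(** * Transfer between module chains and functions on subsets *)

Section TaylorSpanChains.
Variables (k : fieldType) (n q : nat) (m : 'I_q -> 'X_{1..n}).
Variable Delta : {set {set 'I_q}}.
Local Notation Q := {mpoly k[n]}.
Local Notation chain i := {ffun face Delta i -> Q^o}.
Local Notation td := (@taylor_diff k n q m Delta _).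
Hypothesis DeltaD1 : forall A j, A \in Delta -> A :\ j \in Delta.

Definition ext i (x : chain i) (A : {set 'I_q}) : Q :=
  if insub A is Some t then x t else 0.

(* Multiplying the coefficient of e_A by the monomial m_A turns the Taylor
   differential into the boundary map of the full simplex. *)
Definition homogenize i (x : chain i) (A : {set 'I_q}) : Q :=
  ext x A * 'X_[lcm_mon m A].

Lemma ext_val i (x : chain i) t : ext x (val t) = x t.
Proof. by rewrite /ext valK. Qed.

Lemma ext_in i (x : chain i) A (Ai : (A \in Delta) && (#|A| == i)) :
  ext x A = x (exist _ A Ai).
Proof. exact: (ext_val x (exist _ A Ai)). Qed.

Lemma ext_out i (x : chain i) A :
  ~~ ((A \in Delta) && (#|A| == i)) -> ext x A = 0.
Proof. by move=> Ai; rewrite /ext insubN. Qed.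

Lemma sum_face i (x : chain i) (F : {set 'I_q} -> Q) :
  \sum_t x t * F (val t) = \sum_A ext x A * F A.
Proof.
rewrite [RHS](bigID (fun A => (A \in Delta) && (#|A| == i))) /=.
rewrite [X in _ + X]big1 ?addr0 => [|A /ext_out -> //]; last by rewrite mul0r.
rewrite (reindex_omap (val : face Delta i -> _) insub) => [|A Ai].
  by apply: eq_big => [t|t _]; rewrite ?ext_val // valK eqxx (valP t).
by rewrite insubT.
Qed.

Lemma taylor_diffE i (x : chain i.+1) (s : face Delta i) :
  td x s * 'X_[lcm_mon m (val s)] = bd (homogenize x) (val s).
Proof.
pose c A j : Q := (-1) ^+ nbelow A j * 'X_[(lcm_mon m A - lcm_mon m (A :\ j))].
have -> : td x s =
    \sum_A ext x A * \sum_(j in A) c A j * (val s == A :\ j)%:R.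
  rewrite -sum_face /taylor_diff sum_ffunE; apply: eq_bigr => t _.
  rewrite ffunE; congr (_ * _); rewrite sum_ffunE; apply: eq_bigr => j _.
  by rewrite !ffunE.
move: (val s) => B; rewrite mulr_suml; under eq_bigr => A _.
  rewrite mulr_sumr mulr_suml big_mkcond /=.
  over.
(* For a fixed [j], the only set [A] containing [j] with [A :\ j = B] is [j |: B], and it requires
   [j] outside [B]. *)
rewrite exchange_big /= [RHS]big_mkcond /=; apply: eq_bigr => j _.
have [js|js] := boolP (j \in B); rewrite /= -big_mkcond /=.
  rewrite big1 // => A jA; case: eqP => [sA|_]; last by rewrite !(mulr0, mul0r).
  by rewrite sA setD11 in js.
rewrite (bigD1 (j |: B)) ?setU11 //= setU1K // eqxx mulr1 big1 ?addr0.
  rewrite /c setU1K // /homogenize.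
  have <- : nbelow (j |: B) j = nbelow (B) j.
    by rewrite nbelowU1 // ltnn.
  rewrite mulrCA -!mulrA -mpolyXD submK //; exact/lcm_mon_sub/subsetU1.
move=> A /andP[jA As]; case: eqP => [sA|_]; last by rewrite !(mulr0, mul0r).
by rewrite sA setD1K ?eqxx in As.
Qed.

Lemma homogenize_bd i (x : chain i.+1) :
  homogenize (td x) =1 bd (homogenize x).
Proof.
move=> A; have [Ai|Ai] := boolP ((A \in Delta) && (#|A| == i)).
  by rewrite {1}/homogenize (ext_in _ Ai) (taylor_diffE x (exist _ A Ai)).
(* Off the faces both sides vanish: by closure of [Delta], a face [j |: A] would make [A] a face. *)
rewrite {1}/homogenize ext_out // mul0r /bd big1 // => j jA.
rewrite /homogenize ext_out ?mul0r ?mulr0 //.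
apply: contra Ai; rewrite cardsU1 jA eqSS => /andP[/(DeltaD1 j)].
by rewrite setU1K // => -> ->.
Qed.

Lemma homogenize_inj i (x y : chain i) : homogenize x =1 homogenize y -> x = y.
Proof.
move=> xy; apply/ffunP => t; rewrite -!ext_val.
exact: mulX_inj (xy (val t)).
Qed.

Lemma homogenize0 i : homogenize (0 : chain i) =1 (fun=> 0).
Proof.
by move=> A; rewrite /homogenize /ext; case: insub => [t|]; rewrite ?ffunE mul0r.
Qed.

Lemma homogenize_divides i (x : chain i) : lcm_divides m (homogenize x).
Proof. by move=> A b /msupp_mulX. Qed.

Lemma homogenize_concentrated i (x : chain i) : concentrated (homogenize x) i.
Proof.
move=> A; apply: contraNeq => Ai.
by rewrite /homogenize ext_out ?mul0r // (negPf Ai) andbF.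
Qed.

Lemma homogenize_out i (x : chain i) A : A \notin Delta -> homogenize x A = 0.
Proof. by move=> Ai; rewrite /homogenize ext_out ?mul0r // (negPf Ai). Qed.

(** Dividing each [h A] by m_A recovers a chain; with injectivity, this identifies chains with the
    functions meeting the three conditions. *)
Lemma homogenize_surj i h :
  lcm_divides m h -> concentrated h i -> (forall A, A \notin Delta -> h A = 0) ->
  exists x : chain i, homogenize x =1 h.
Proof.
move=> h_div hi hDelta.
have /fin_all_exists[r hr] (A : {set 'I_q}) := mpoly_divX (@h_div A).
exists [ffun t => r (val t)] => A; rewrite /homogenize.
have [Ai|Ai] := boolP ((A \in Delta) && (#|A| == i)).
  by rewrite (ext_in _ Ai) ffunE -hr.
rewrite ext_out // mul0r; move: Ai; rewrite negb_and => /orP[/hDelta ->//|Ai].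
by apply/esym/eqP; apply: contraNT Ai => /hi ->.
Qed.

Lemma taylor_span_exact :
  (forall g d, lcm_divides m g -> concentrated g d.+1 -> bd g =1 (fun=> 0) ->
     (forall A, A \notin Delta -> g A = 0) ->
     exists h : {set 'I_q} -> Q, [/\ lcm_divides m h, concentrated h d.+2,
       bd h =1 g & forall A, A \notin Delta -> h A = 0]) ->
  forall i (x : chain i.+1), td x = 0 <-> exists y : chain i.+2, td y = x.
Proof.
move=> exact_g i x; split=> [dx|[y <-]]; last first.
  apply: homogenize_inj => A; rewrite homogenize0 homogenize_bd.
  by rewrite (eq_bd (homogenize_bd y)) bd_bd.
have [|h [h_div hd bdh hDelta]] := exact_g _ _ (@homogenize_divides _ x)
  (@homogenize_concentrated _ x) _ (@homogenize_out _ x).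
  by move=> A; rewrite -homogenize_bd dx homogenize0.
have [y yh] := homogenize_surj h_div hd hDelta.
exists y; apply: homogenize_inj => A.
by rewrite homogenize_bd (eq_bd yh) bdh.
Qed.

End TaylorSpanChains.

(** * Augmentation and minimality *)

Section Resolution.
Variables (k : fieldType) (n q : nat) (m : 'I_q -> 'X_{1..n}).
Variable Delta : {set {set 'I_q}}.
Local Notation Q := {mpoly k[n]}.
Local Notation chain i := {ffun face Delta i -> Q^o}.
Local Notation td := (@taylor_diff k n q m Delta _).

(** The module F_0 is free on the empty face, so the augmentation is its coefficient modulo [I]. The
    singletons map to the generators, so the image of F_1 is [I]. *)
Lemma taylor_span_resolution (I : idealr Q) :
  generated_by m setT (I : {pred Q}) ->
  set0 \in Delta -> (forall i, [set i] \in Delta) ->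
  (forall i (x : chain i.+1), td x = 0 <-> exists y : chain i.+2, td y = x) ->
  is_resolution I (taylor_span k m Delta).
Proof.
move=> genI D0 D1 ex_i; split; last exact: ex_i.
have t0P : (set0 \in Delta) && (#|(set0 : {set 'I_q})| == 0%N) by rewrite D0 cards0.
pose t0 : face Delta 0 := exist _ set0 t0P.
have t0E (t : face Delta 0) : t = t0.
  by apply: val_inj => /=; case/andP: (valP t) => _; rewrite cards_eq0 => /eqP.
pose pi := \pi_{ideal_quot I} : Q -> {ideal_quot I}.
pose e (x : chain 0) : {ideal_quot I} := pi (x t0).
have e_lin : linear_for (pi \; *%R) e.
  by move=> a x y; rewrite /e !ffunE /pi rmorphD rmorphM.
pose eM := GRing.isLinear.Build _ _ _ _ e e_lin.
pose eL : {linear chain 0 -> {ideal_quot I} | pi \; *%R} := HB.pack e eM.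
exists eL; split=> [z|x].
  exists [ffun=> repr z]; rewrite /eL /= /e ffunE; exact: reprK.
rewrite /eL /= /e.
have td0 (y : chain 1) : td y t0 = \sum_j ext y [set j] * 'X_[m j].
  rewrite -[LHS]mulr1 -mpolyX0 -(lcm_mon0 m) (taylor_diffE m y t0).
  rewrite /bd (eq_bigl xpredT) => [|j]; last by rewrite inE.
  apply: eq_bigr => j _; rewrite setU0 /homogenize lcm_mon1.
  suff -> : nbelow (set0 : {set 'I_q}) j = 0%N by rewrite mul1r.
  by apply/eqP; rewrite cards_eq0; apply/eqP/setP => l; rewrite !inE.
have piI : pi (x t0) = 0 <-> x t0 \in I.
  rewrite -[X in X \in I]subr0 Quotient.idealrBE.
  by rewrite -(rmorph0 pi); split=> /eqP.
apply: (iff_trans piI); apply: (iff_trans (genI _)); split=> [[c xc]|[y <-]]; last first.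
  by exists (fun i => ext y [set i]); rewrite td0; apply: eq_bigl => i; rewrite inE.
(* On a face [[set i]] the sum has the single term [c i]. *)
exists [ffun t => \sum_(i | val t == [set i]) c i]; apply/ffunP => t.
rewrite (t0E t) td0 xc; apply: eq_big => [i|i _]; first by rewrite inE.
congr (_ * _).
have iP : ([set i] \in Delta) && (#|[set i]| == 1%N) by rewrite D1 cards1.
rewrite (ext_in _ iP) ffunE /=.
by rewrite (big_pred1 i) // => j; rewrite (inj_eq set1_inj) eq_sym.
Qed.

Lemma max_ideal_X (a : 'X_{1..n}) : a != 0%MM -> max_ideal ('X_[a] : Q).
Proof.
move=> a0; have [j aj] : exists j, a j != 0%N.
  apply/existsP; apply: contraR a0; rewrite negb_exists => /forallP a0.
  by apply/eqP/mnmP => j; rewrite mnm0E; apply/eqP; have := a0 j; rewrite negbK.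
exists (fun l => if l == j then 'X_[a - U_(j)] else 0).
rewrite (bigD1 j) //= eqxx big1 ?addr0 => [|l /negPf->]; last by rewrite mul0r.
by rewrite -mpolyXD submK // lep1mP.
Qed.

Lemma ideal_mul_sum (J : Q -> Prop) (V : lmodType Q) (T : finType)
    (P : pred T) (F : T -> V) :
  (forall t, P t -> ideal_mul J (F t)) -> ideal_mul J (\sum_(t | P t) F t).
Proof.
move=> JF; apply: big_ind => //; first by exists [::]; rewrite ?big_nil.
move=> u v [r Jr ->] [s Js ->]; exists (r ++ s); last by rewrite big_cat.
by move=> a; rewrite mem_cat => /orP[/Jr|/Js].
Qed.

(** When the two lcms differ, the monomial quotient in the differential has a nonzero exponent,
    hence a variable as a factor. *)
Lemma taylor_span_minimal :
  (forall A j, A \in Delta -> j \in A -> lcm_mon m (A :\ j) != lcm_mon m A) ->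
  is_minimal (@max_ideal k n) (taylor_span k m Delta).
Proof.
move=> lcm_neq i x; apply: ideal_mul_sum => t _.
rewrite scaler_sumr; apply: ideal_mul_sum => j jt.
pose a := (lcm_mon m (val t) - lcm_mon m (val t :\ j))%MM.
pose c : Q := (-1) ^+ #|[set l in val t | (l < j)%N]|.
exists [:: ('X_[a] : Q, (x t * c : Q) *: @taylor_basis k n q Delta i (val t :\ j))]; last first.
  by rewrite big_seq1 /= !scalerA; congr (_ *: _); rewrite mulrA mulrC.
move=> _ /[!inE] /eqP -> /=; apply: max_ideal_X.
have /andP[tD _] := valP t.
apply: contra (lcm_neq _ _ tD jt) => /eqP a0.
by rewrite -[X in _ == X](submK (lcm_mon_sub m (subD1set _ j))) -/a a0 add0m.
Qed.
End Resolution.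

(** * Minimal generators, twins and the choice of the pivot *)

Section MinimalGenerators.
Variables (k : fieldType) (n q : nat) (m : 'I_q -> 'X_{1..n}).
Local Notation Q := {mpoly k[n]}.
Variables (I : idealr Q) (hI : minimal_generators m (I : {pred Q})).

(** A generator equal to 1 would put 1 in the proper ideal [I]. *)
Lemma generator_neq0 i : m i != 0%MM.
Proof.
apply/eqP => mi0; have := idealr1 I; suff -> : 1 \in I by [].
apply/(proj1 hI); exists (fun j => (j == i)%:R).
rewrite (bigD1 i) ?inE //= eqxx mi0 mpolyX0 mulr1 big1 ?addr0 //.
by move=> j /andP[_ /negPf->]; rewrite mul0r.
Qed.

(** If m_i divides m_j with [i] and [j] distinct, the coefficient of m_j can be absorbed into that
    of m_i, so m_j is redundant. *)
Lemma generator_antichain i j : (m i <= m j)%MM -> i = j.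
Proof.
move=> mij; apply/eqP; apply: contraT => ij.
suff /(proj2 hI)/setP/(_ j) : generated_by m (setT :\ j) (I : {pred Q}).
  by rewrite !inE eqxx.
move=> p; rewrite (proj1 hI); split=> -[c ->].
  exists (fun l => if l == i then c i + c j * 'X_[m j - m i] else c l).
  rewrite (bigD1 j) ?inE //= (bigD1 i) ?inE ?ij //= [RHS](bigD1 i) ?inE ?ij //=.
  rewrite eqxx addrA mulrDl -mulrA -mpolyXD submK // [X in X + _ = _]addrC.
  congr (_ + _); apply: eq_big => [l|l /andP[_ /negPf->] //].
  by rewrite !inE !andbT.
exists (fun l => if l == j then 0 else c l).
rewrite [RHS](bigD1 j) ?inE //= eqxx mul0r add0r.
by apply: eq_big => [l|l]; rewrite !inE andbT //= => /negPf->.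
Qed.

Lemma twin_card1 A : has_twin m A -> (0 < #|A|)%N.
Proof.
rewrite card_gt0; apply: contraTneq => ->; apply/existsPn => B.
apply/negP => /andP[]; rewrite eq_sym => /set0Pn[i iB] /eqP.
rewrite lcm_mon0 => B0; have := le_lcm_mon m iB; rewrite -B0 => mi.
have /negP[] := generator_neq0 i; apply/eqP/(lem_anti mi).
by apply/mnm_lepP => l; rewrite mnm0E.
Qed.

(** A twin of [[set i]] consists of generators dividing m_i, so it is [[set i]] itself or empty; the
    latter would force m_i = 1. *)
Lemma twin_card2 A : has_twin m A -> (1 < #|A|)%N.
Proof.
move=> twA; have A0 := twin_card1 twA; rewrite ltn_neqAle A0 andbT.
apply: contraTneq twA => /esym/eqP/cards1P[i ->].
apply/existsPn => B; apply/negP => /andP[iB /eqP].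
rewrite lcm_mon1 => iE; case/negP: iB.
have Bi : B \subset [set i].
  apply/subsetP => j jB; rewrite inE; apply/eqP/generator_antichain.
  by rewrite iE le_lcm_mon.
move: Bi; rewrite subset1 => /orP[/eqP->//|/eqP B0].
by move: iE (generator_neq0 i); rewrite B0 lcm_mon0 => ->; rewrite eqxx.
Qed.

Lemma scarf_numberP t :
  reflect (forall A, has_twin m A -> (t <= #|A|)%N) (leq_inf t (scarf_number m)).
Proof.
rewrite /scarf_number; case: pickP => [A0 twA0|no_twin] /=; last first.
  by left=> A; rewrite no_twin.
case: arg_minnP => // A twA A_min.
by apply: (iffP idP) => [tA B /A_min|]; [apply: leq_trans | apply].
Qed.

Lemma taylor_minimal_pivot :
  (forall (A : {set 'I_q}) (j : 'I_q), j \in A -> lcm_mon m (A :\ j) != lcm_mon m A) ->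
  has_minimal_pivot_resolution m I.
Proof.
move=> lcm_neq; exists (taylor_span k m setT); split; first by left.
  apply: taylor_span_resolution => [||i|i x]; rewrite ?inE //.
    exact: (proj1 hI).
  apply: taylor_span_exact => [*|g d g_div gd bdg _]; first by rewrite inE.
  have [h [h_div hd bdh]] := taylor_exact g_div gd bdg.
  by exists h; split=> // A; rewrite inE.
by apply: taylor_span_minimal => A j _; apply: lcm_neq.
Qed.

Lemma scarf_minimal_pivot :
  (forall A, has_twin m A -> (q.-1 <= #|A|)%N) ->
  has_minimal_pivot_resolution m I.
Proof.
move=> twin_card.
have big_twin (A : {set 'I_q}) (j : 'I_q) :
    j \in A -> lcm_mon m (A :\ j) = lcm_mon m A -> A = setT.
  move=> jA lcmA; have twA : has_twin m (A :\ j).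
    apply/existsP; exists A; rewrite lcmA eqxx andbT.
    by apply: contraTneq jA => <-; rewrite setD11.
  (* The twin [A :\ j] has at least [q.-1] elements, and [j] is one more. *)
  apply/eqP; rewrite eqEcard subsetT cardsT card_ord (cardsD1 j) jA.
  by apply: leq_trans (leqSpred q) _; rewrite add1n ltnS twin_card.
have [/existsP[j0 /eqP lcmP]|no_twin] :=
    boolP [exists j, lcm_mon m (setT :\ j) == lcm_mon m setT]; last first.
  apply: taylor_minimal_pivot => A j jA; apply: contraNneq no_twin => lcmA.
  by apply/existsP; exists j; rewrite -(big_twin A j) // lcmA.
(* The pivot set is a twin of [setT], so it has the two elements that a pivot complex requires; this
   also keeps the empty set and the singletons as faces. *)
have P2 : (1 < #|setT :\ j0|)%N.
  apply: twin_card2; apply/existsP; exists setT; rewrite lcmP eqxx andbT.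
  by apply/eqP => /setP/(_ j0); rewrite !inE eqxx.
have out (A : {set 'I_q}) : A \notin pivot_faces (setT :\ j0) -> A = setT \/ A = setT :\ j0.
  rewrite inE negbK => PA; have [jA|jA] := boolP (j0 \in A); [left|right].
    by apply/eqP; rewrite eqEsubset subsetT -(setD1K (in_setT j0)) subUset sub1set jA.
  apply/eqP; rewrite eqEsubset PA andbT; apply/subsetP => i iA.
  by rewrite !inE andbT; apply: contraNneq jA => <-.
have smallP (A : {set 'I_q}) : (#|A| <= 1)%N -> A \in pivot_faces (setT :\ j0).
  move=> A1; rewrite inE; apply: contraL P2 => /subset_leq_card PA.
  by rewrite -leqNgt (leq_trans PA).
exists (taylor_span k m (pivot_faces (setT :\ j0))); split.
- by right; exists (setT :\ j0).
- apply: taylor_span_resolution => [|||i x].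
  + exact: (proj1 hI).
  + by rewrite smallP ?cards0.
  + by move=> i; rewrite smallP ?cards1.
  apply: taylor_span_exact => [|g d g_div gd bdg gD]; first exact: pivot_faces_closed.
  have [|h [h_div hd bdh [hP hT]]] := pivot_exact lcmP g_div gd bdg.
    by apply: gD; rewrite inE subxx.
  by exists h; split=> // A /out[]->.
apply: taylor_span_minimal => A j AD jA; apply: contraTneq AD => /(big_twin _ _ jA)->.
by rewrite inE subsetT.
Qed.

End MinimalGenerators.

(* [idealr] is the library's type of proper ideals. *)
Theorem theorem3p10 (k : fieldType) (n q : nat) (I : idealr {mpoly k[n]})
    (m : 'I_q -> 'X_{1..n}) (hI : minimal_generators m (I : {pred {mpoly k[n]}})) :
  (leq_inf q.-1 (scarf_number m) -> has_minimal_pivot_resolution m I) /\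
  ((q <= 3)%N -> has_minimal_pivot_resolution m I).
Proof.
split=> [/scarf_numberP|q3]; first exact: scarf_minimal_pivot.
apply: scarf_minimal_pivot => // A /(twin_card2 hI) A2.
(* For [q] at most 3, [q.-1] is at most 2. *)
by apply: leq_trans A2; rewrite -subn1 leq_subLR.
Qed.
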